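(* For any $\varepsilon>0$ there is $n_0$ so that the following holds for all $n>n_0$. There exists an $n$-vertex graph $G$ with minimum degree at least $(1-\varepsilon)\sqrt{\tfrac{n\log n}{2}}$ so that if $F\sim G_{n,2}$ is a random $2$-regular graph on the same vertex set as $G$ then with high probability $G\cup F$ is not Hamiltonian.
   Context: Graphs are finite and simple; $\log$ is the natural logarithm. $G_{n,2}$ denotes the uniform distribution on all simple $2$-regular graphs on the given labelled $n$-element vertex set (equivalently, the cycle graph of a uniformly random permutation conditioned on all cycles having length at least three). $G\cup F$ is the graph on the common vertex set whose edge set is $E(G)\cup E(F)$. A graph is Hamiltonian if it contains a cycle through all of its vertices. ''With high probability'' means with probability $1-o(1)$ as $n\to\infty$ (for fixed $\varepsilon$); the only randomness is in $F$.
   Formalization: The two descriptions of G_{n,2} called equivalent differ (for n = 6, a pair of triangles has twice a hexagon's mass in the permutation model); the theorem is proved for the cycle graph of a uniform permutation conditioned on all cycles having length at least 3, not for the uniform law. *)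

(* Defs.v *)
From mathcomp Require Import all_boot all_order all_fingroup all_algebra.
From mathcomp Require Import all_classical all_reals all_analysis.
Set Implicit Arguments.
Unset Strict Implicit.
Unset Printing Implicit Defensive.
Import Order.TTheory GRing.Theory Num.Theory.
Import numFieldNormedType.Exports.
Local Open Scope ring_scope.

Definition simple_edges (V : finType) (E : {set {set V}}) : bool :=
  [forall e in E, #|e| == 2%N].

Record sgraph (V : finType) :=
  SGraph { edges : {set {set V}}; edgesP : simple_edges edges }.

Section Graphs.
Variable V : finType.
Implicit Types (G F : sgraph V) (s : {perm V}).

Definition adj G : rel V := fun u v => [set u; v] \in edges G.

Definition degree G (v : V) : nat := #|[set u | adj G v u]|.

(* The default value #|V| exceeds every degree, so it never matters when V is
   nonempty. *)
Definition min_degree G : nat := \big[minn/#|V|]_(v : V) degree G v.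

Definition regular (k : nat) G : Prop := forall v, degree G v = k.

Lemma simple_edgesU G F : simple_edges (edges G :|: edges F).
Proof.
apply/forall_inP => e; rewrite inE => /orP[].
- exact: (forall_inP (edgesP G)).
- exact: (forall_inP (edgesP F)).
Qed.

Definition gunion G F : sgraph V := SGraph (simple_edgesU G F).

Definition hamiltonian G : Prop :=
  exists c : seq V, [/\ (3 <= size c)%N, ucycle (adj G) c & forall v, v \in c].

(* Fixed points of s contribute no edge, and a 2-cycle of s a single one. *)
Definition cycle_edges s : {set {set V}} :=
  [set [set v; s v] | v in [set v | s v != v]].

Lemma cycle_edges_simple s : simple_edges (cycle_edges s).
Proof.
apply/forall_inP => e /imsetP[v]; rewrite inE => sv ->.
by rewrite cards2 (eq_sym v) sv.
Qed.

Definition cycle_graph s : sgraph V := SGraph (cycle_edges_simple s).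

Definition long_cycles s : bool := [forall v, 3 <= #|porbit s v|]%N.

Lemma cycle_graph_regular s : long_cycles s -> regular 2 (cycle_graph s).
Proof.
move=> /forallP ls v.
have sv w : s w != w.
  apply: contraTneq (ls w) => sw.
  rewrite -leqNgt; apply: (@leq_trans 1%N) => //.
  rewrite -(cards1 w); apply/subset_leq_card/fintype.subsetP => x.
  move=> /porbitP[i ->]; rewrite inE permX.
  by elim: i => //= i /eqP ->; rewrite sw.
have ssv : s (s v) != v.
  apply: contraTneq (ls v) => ssv.
  rewrite -leqNgt; apply: (@leq_trans #|[set v; s v]|); last first.
    by rewrite cards2 ltnS leq_b1.
  apply/subset_leq_card/fintype.subsetP => x.
  move=> /porbitP[i ->]; rewrite permX.
  elim: i => [|i] /=; first by rewrite !inE eqxx.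
  by rewrite !inE => /orP[] /eqP ->; rewrite ?ssv eqxx ?orbT.
rewrite /degree.
have -> : [set u | adj (cycle_graph s) v u] = [set s v; (s^-1)%g v].
  apply/setP => u; rewrite !inE /adj /=; apply/imsetP/orP => [[w _ e]|].
    have vw : v \in [set w; s w] by rewrite -e !inE eqxx.
    have uw : u \in [set w; s w] by rewrite -e !inE eqxx orbT.
    have ww : w \in [set v; u] by rewrite e !inE eqxx.
    have sw : s w \in [set v; u] by rewrite e !inE eqxx orbT.
    move: vw; rewrite !inE => /orP[] /eqP vE; subst v.
      by left; move: sw; rewrite !inE (negbTE (sv w)) eq_sym.
    right; rewrite permK; move: ww.
    by rewrite !inE (eq_sym w) (negbTE (sv w)) eq_sym.
  case=> /eqP ->; first by exists v; rewrite ?inE.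
  by exists ((s^-1)%g v); rewrite ?inE ?sv // permKV finset.setUC.
rewrite cards2; suff -> : s v != (s^-1)%g v by [].
by rewrite -(inj_eq (@perm_inj _ s)) permKV.
Qed.

(* G_{n,2} as the law of the cycle graph of a uniformly random permutation of V
   conditioned on all its cycles having length at least three.  A 2-regular
   graph with c cycles is the cycle graph of 2 ^ c such permutations, so this
   law is not the one giving equal mass to every 2-regular graph (for n = 6,
   each hexagon has mass 2/160 and each pair of triangles 4/160).  The number
   of k-cycles has asymptotic mean 1/k here but 1/(2k) for equal masses, and
   the constant in sqrt (n log n / 2) is the one that belongs to 1/k. *)
Definition Gn2_pr (R : realType) (A : sgraph V -> Prop) : R :=
  #|[set s | long_cycles s && `[< A (cycle_graph s) >]]|%:R
    / #|[set s | long_cycles s]|%:R.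

End Graphs.

(* Main.v *)
Require Import Defs.
From mathcomp Require Import all_boot all_order all_fingroup all_algebra.
From mathcomp Require Import all_classical all_reals all_analysis.
From mathcomp Require Import zify ring lra.
Set Implicit Arguments.
Unset Strict Implicit.
Unset Printing Implicit Defensive.
Import Order.TTheory GRing.Theory Num.Theory.
Import numFieldNormedType.Exports.
Local Open Scope ring_scope.

(** Fix a set A of m vertices, let B be its complement, and let G be the
complete bipartite graph between A and B, so that the minimum degree of G is m
as long as m <= n / 2.  Let s be the random permutation whose cycle graph is F.
Write X for the number of cycles of s that avoid A, and Y for the number of
a in A with s a in A.

_A Hamilton cycle forces X <= Y_ ([hamiltonian_avoiding_le_inner]).  A Hamilton
cycle of G u F has at least |B| - m edges inside B, because each vertex of A
spoils at most two of its n = |B| + m edges.  All edges inside B come from F,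
which has |B| - (m - Y) of them.  Each cycle of F inside B must contribute an
edge that the Hamilton cycle does not use, as otherwise the Hamilton cycle would
never leave it.  Hence |B| - m <= |B| - m + Y - X.

_X is large._  Grow s by inserting the elements of B one at a time into a
permutation of A.  The t-th element either becomes a fixed point, with
probability 1/t, creating a cycle that avoids A, or it is inserted into an
existing cycle, which changes neither the number of cycles nor which of them
meet A.  So X is a sum of independent indicators with means 1/t for m < t <= n:
its mean h is about ln (n / m), and its variance is at most h
([avoiding_variance]).

_Y is small._  Its mean is mu = m^2 / n, and its variance is at most mu
([inner_variance]).

With m = (1 - e) sqrt (n ln n / 2), mu is at most (1 - e) ln n / 2, while h is
(1/2 - o(1)) ln n since m = n^(1/2 + o(1)).  So h - mu is at least of order
ln n, whereas the standard deviations are of order sqrt (ln n), and Chebyshev's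
inequality gives X > Y except with probability O(1 / ln n).  Conditioning on
all cycles being long multiplies this by at most 5, because at least a fifth of
all permutations have no cycle of length 1 or 2 ([card_long_cycles]). *)

(** * Cycles avoiding a set, by inserting elements one at a time *)

Section Insertion.
Variable T : finType.
Implicit Types (S A : {set T}) (s u : {perm T}).

Lemma mem_Sym S s : (s \in Sym S) = perm_on S s.
Proof. by rewrite inE. Qed.

Lemma Sym_out S s x : s \in Sym S -> x \notin S -> s x = x.
Proof. by rewrite mem_Sym; apply: out_perm. Qed.

Lemma Sym_closed S s x : s \in Sym S -> (s x \in S) = (x \in S).
Proof. by rewrite mem_Sym => /perm_closed. Qed.

(** For u fixing b, [tperm b c * u] is u with b spliced into its cycle right
after c (when c = b, left as a fixed point); c is recovered as the predecessor
of b. *)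
Lemma Sym_insert S b c u : b \notin S -> c \in b |: S ->
  (tperm b c * u \in Sym (b |: S))%g && ((tperm b c * u)^-1 b == c)%g =
  (u \in Sym S).
Proof.
move=> bS cS; apply/andP/idP => [[ts /eqP tc]|uS].
  have ub : u b = b.
    have := congr1 (tperm b c * u)%g tc.
    by rewrite permKV permM tpermR.
  rewrite mem_Sym; apply/fintype.subsetP => x; rewrite inE; apply: contraNT => xS.
  have [->|xb] := eqVneq x b; first by rewrite ub.
  have xbS : x \notin b |: S by rewrite !inE negb_or xb.
  have xc : x != c by apply: contraNneq xbS => ->.
  by have := Sym_out ts xbS; rewrite permM tpermD ?(eq_sym _ x) // => ->.
split.
  rewrite mem_Sym; apply/fintype.subsetP => x; rewrite inE; apply: contraNT => xbS.
  have xc : x != c by apply: contraNneq xbS => ->.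
  move: xbS; rewrite !inE negb_or => /andP[xb xS].
  by rewrite permM tpermD ?(eq_sym _ x) // (Sym_out uS).
apply/eqP; apply: (@perm_inj _ (tperm b c * u)%g).
by rewrite permKV permM tpermR (Sym_out uS bS).
Qed.

Lemma sum_Sym_insert (V : nmodType) S b (f : {perm T} -> V) : b \notin S ->
  \sum_(s in Sym (b |: S)) f s =
  \sum_(c in b |: S) \sum_(u in Sym S) f (tperm b c * u)%g.
Proof.
move=> bS.
rewrite (partition_big (fun s : {perm T} => (s^-1)%g b) (mem (b |: S))) /=.
  apply: eq_bigr => c cS.
  rewrite (reindex_inj (mulgI (tperm b c))) /=.
  by apply: eq_bigl => u; rewrite Sym_insert.
move=> s sS; rewrite -(Sym_closed _ sS) permKV.
by rewrite !inE eqxx.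
Qed.

Section Orbits.
Variables (S : {set T}) (b c : T) (u : {perm T}).
Hypotheses (bS : b \notin S) (cS : c \in S) (uS : u \in Sym S).
Let s : {perm T} := (tperm b c * u)%g.

Lemma insert_neq : c != b.
Proof. by apply: contraNneq bS => <-. Qed.

Lemma insert_b : s b = u c.
Proof. by rewrite /s permM tpermL. Qed.

Lemma insert_c : s c = b.
Proof. by rewrite /s permM tpermR (Sym_out uS). Qed.

Lemma insertD x : x != b -> x != c -> s x = u x.
Proof. by move=> xb xc; rewrite /s permM tpermD // eq_sym. Qed.

(** Splicing b into a cycle does not change which of the other elements lie in a
common cycle. *)
Lemma insert_porbit x y : x != b -> y != b ->
  (porbit s x == porbit s y) = (porbit u x == porbit u y).
Proof.
move=> xb yb; rewrite !eq_porbit_mem.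
have step z : u z \in porbit s z.
  have [->|zc] := eqVneq z c.
    rewrite -insert_b -insert_c.
    by rewrite -!permM -(expg1 s) -!expgS mem_porbit.
  have [->|zb] := eqVneq z b.
    by rewrite (Sym_out uS bS) porbit_id.
  by rewrite -insertD // -{1}(expg1 s) mem_porbit.
(* Collapsing b onto its predecessor c maps each s-step to a u-step or to a
   standstill. *)
pose f z := if z == b then c else z.
have fstep z : porbit u (f (s z)) = porbit u (f z).
  have pu w : porbit u (u w) = porbit u w.
    by apply/eqP; rewrite eq_porbit_mem -{1}(expg1 u) mem_porbit.
  rewrite /f; have [->|zb] := eqVneq z b.
    rewrite insert_b ifN ?pu //.
    by apply: contraNneq bS => <-; rewrite Sym_closed.
  have [->|zc] := eqVneq z c; first by rewrite insert_c eqxx.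
  rewrite insertD // ifN ?pu //.
  by apply: contra zb => /eqP e; rewrite -(inj_eq (@perm_inj _ u)) e (Sym_out uS).
apply/idP/idP => /porbitP[i xE].
  have fE z : z != b -> f z = z by rewrite /f => /negbTE ->.
  have : porbit u (f ((s ^+ i)%g y)) = porbit u (f y).
    by elim: i {xE} => [|i ih]; rewrite ?perm1 // expgSr permM fstep.
  by rewrite -xE !fE // => <-; rewrite porbit_id.
rewrite {}xE; elim: i => [|i ih]; first by rewrite perm1 porbit_id.
rewrite expgSr permM; move: ih; rewrite -!eq_porbit_mem => /eqP <-.
by rewrite eq_porbit_mem.
Qed.

Lemma insert_porbits : #|porbits s|.+1 = #|porbits u|.
Proof.
have := porbits_mul_tperm u b c.
have -> : b \notin porbit u c.
  apply/negP => /porbitP[i bE].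
  have : (u ^+ i)%g c \in S by rewrite (Sym_closed _ (groupX i uS)).
  by rewrite -bE (negbTE bS).
by rewrite eq_sym insert_neq /= -/s; lia.
Qed.

Lemma insert_porbit_card (A : {set T}) : A \subset S ->
  #|porbit s @: A| = #|porbit u @: A|.
Proof.
move=> AS.
have Ab x : x \in A -> x != b.
  by move=> xA; apply: contraNneq bS => <-; apply: (fintype.subsetP AS).
(* g reads off the u-cycle corresponding to an s-cycle that meets A. *)
pose g (O : {set T}) := porbit u (odflt b [pick x in O :&: A]).
have gE x : x \in A -> g (porbit s x) = porbit u x.
  move=> xA; rewrite /g; case: pickP => [y|/(_ x)] /=.
    rewrite inE => /andP[yx yA]; apply/eqP.
    by rewrite -insert_porbit ?Ab // eq_porbit_mem.
  by rewrite inE porbit_id xA.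
have -> : porbit u @: A = g @: (porbit s @: A).
  by rewrite -imset_comp; apply: eq_in_imset => x xA /=; rewrite gE.
rewrite [RHS]card_in_imset // => _ _ /imsetP[x xA ->] /imsetP[y yA ->].
by rewrite !gE // => /eqP e; apply/eqP; rewrite insert_porbit ?Ab.
Qed.

End Orbits.

Definition avoiding A s := [set O in porbits s | [disjoint O & A]].

Lemma card_avoiding A s : (#|avoiding A s| + #|porbit s @: A| = #|porbits s|)%N.
Proof.
have -> : porbit s @: A = [set O in porbits s | ~~ [disjoint O & A]].
  apply/setP => O; rewrite !inE; apply/imsetP/andP.
    move=> [x xA ->]; split; first exact: imset_f.
    by apply/pred0Pn; exists x; rewrite /= porbit_id.
  move=> [/imsetP[y _ ->]] /pred0Pn[x /andP[/= xy xA]]; exists x => //.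
  by apply/eqP; rewrite eq_sym eq_porbit_mem.
rewrite -cardsUI [X in (_ + #|pred_of_set X|)%N](_ : _ = finset.set0) ?cards0 ?addn0.
  by apply: eq_card => O; rewrite !inE -andb_orr orbN andbT.
by apply/setP => O; rewrite !inE andbACA andbN andbF.
Qed.

Lemma avoiding_Sym A s : s \in Sym A -> #|avoiding A s| = #|~: A|.
Proof.
move=> sA.
have fx x : x \notin A -> porbit s x = [set x].
  move=> xA; apply/setP => y; rewrite inE; apply/porbitP/eqP => [[i ->]|->].
    by apply: Sym_out xA; apply: groupX.
  by exists 0%N; rewrite perm1.
have -> : avoiding A s = finset.set1 @: (~: A).
  apply/setP => O; rewrite !inE; apply/andP/imsetP.
    move=> [/imsetP[x _ ->]] dx.
    have xA : x \notin A.
      by apply: contraTN dx => xA; apply/pred0Pn; exists x; rewrite /= porbit_id.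
    by exists x; rewrite ?inE // fx.
  move=> [x]; rewrite inE => xA ->; split; last by rewrite disjoints1.
  by rewrite -(fx _ xA); apply: imset_f.
by rewrite card_imset //; apply: finset.set1_inj.
Qed.

(** A fixed point b outside A counts as a cycle avoiding A; splicing b into
another cycle loses it.  The total number of cycles drops by one, while the
number of those meeting A is unchanged. *)
Lemma avoiding_insert A S b c u : A \subset S -> b \notin S -> c \in b |: S ->
    u \in Sym S ->
  (#|avoiding A (tperm b c * u)%g| + (c != b) = #|avoiding A u|)%N.
Proof.
move=> AS bS /setU1P[->|cS] uS.
  by rewrite eqxx addn0 tperm1 mul1g.
have := insert_porbits bS cS uS; have := insert_porbit_card bS cS uS AS.
have := card_avoiding A u; have := card_avoiding A (tperm b c * u)%g.
by rewrite (insert_neq bS cS); lia.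
Qed.

(** The subtraction of #|~: S| discards the fixed points of s outside S, so this
bounds the variance of the number of cycles avoiding A of a uniform permutation
of S.  Inserting b replaces the centred variable Y u by Y u + [c = b] - 1/t,
where c is uniform among the t elements of b |: S; the increment has mean zero, so the
cross term vanishes, and its variance is at most 1/t. *)
Lemma avoiding_variance (R : realFieldType) A S : A \subset S ->
  let h : R := \sum_(#|A| <= i < #|S|) i.+1%:R^-1 in
  \sum_(s in Sym S) (#|avoiding A s|%:R - #|~: S|%:R - h) ^+ 2
    <= (#|S|)`!%:R * h.
Proof.
have [k] := ubnP (#|S| - #|A|)%N; elim: k S => // k ih S lek AS.
have [SA|] := boolP (S \subset A).
  have -> : S = A by apply/eqP; rewrite finset.eqEsubset SA.
  rewrite big_geq //= mulr0 big1 // => s sA.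
  by rewrite avoiding_Sym // subrr subr0 expr0n.
case/subsetPn => b bS bA.
have SE : S = b |: (S :\ b) by rewrite finset.setD1K.
set S' := S :\ b in SE.
have bS' : b \notin S' by rewrite !inE eqxx.
have AS' : A \subset S'.
  apply/fintype.subsetP => x xA; rewrite !inE (fintype.subsetP AS) // andbT.
  by apply: contraNneq bA => <-.
have cS : #|S| = #|S'|.+1 by rewrite SE cardsU1 bS'.
have cC : #|~: S'| = #|~: S|.+1.
  by have := cardsC S; have := cardsC S'; rewrite cS; lia.
have /= := ih S' _ AS'; have leA := subset_leq_card AS'.
move=> /(_ ltac:(by move: lek; rewrite cS; lia)).
rewrite /= cS big_nat_recr //=.
set h := \sum_(_ <= i < _) _; set t : R := (#|S'|.+1)%:R.
rewrite {1}SE sum_Sym_insert // => hih.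
have t0 : t != 0 by rewrite pnatr_eq0.
pose Y u : R := #|avoiding A u|%:R - #|~: S'|%:R - h.
have -> : \sum_(c in b |: S') \sum_(u in Sym S')
      (#|avoiding A (tperm b c * u)%g|%:R - #|~: S|%:R - (h + t^-1)) ^+ 2 =
    \sum_(u in Sym S') (t * Y u ^+ 2 + (1 - t^-1)).
  rewrite exchange_big /=; apply: eq_bigr => u uS.
  have term c : c \in b |: S' ->
      #|avoiding A (tperm b c * u)%g|%:R - #|~: S|%:R - (h + t^-1)
      = Y u + (c == b)%:R - t^-1.
    move=> cS'; rewrite /Y -(avoiding_insert AS' bS' cS' uS) cC.
    by case: (c == b) => /=; rewrite natrD -(natr1 #|~: S|); ring.
  rewrite (eq_bigr (fun c => (Y u + (c == b)%:R - t^-1) ^+ 2)); last first.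
    by move=> c cS'; rewrite term.
  rewrite big_setU1 //= eqxx.
  rewrite (eq_bigr (fun=> (Y u - t^-1) ^+ 2)); last first.
    move=> c cS'; rewrite (_ : c == b = false) ?addr0 //.
    by apply: contraNF bS' => /eqP <-.
  have tE : #|S'|%:R = t - 1 :> R by rewrite /t -natr1 addrK.
  rewrite sumr_const -[_ *+ #|S'|]mulr_natr tE.
  by rewrite /=; field.
rewrite big_split /= -mulr_sumr sumr_const card_Sym factS natrM mulrDr.
rewrite lerD //; first by rewrite -mulrA ler_wpM2l ?ler0n.
rewrite -/t mulrAC mulfV // mul1r -[leLHS]mulr_natr.
by rewrite ler_piMl ?ler0n // lerBlDr lerDl invr_ge0 ler0n.
Qed.

End Insertion.

(** * Second moment of the number of arcs inside a set *)

Section Inner.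
Variable T : finType.
Implicit Types (A : {set T}) (s u : {perm T}).

Definition inner A s := [set a in A | s a \in A].

(** Multiplying by a transposition shows that every value of s a is equally
likely. *)
Lemma card_perm_at (a b : T) :
  (#|T| * #|[set s : {perm T} | s a == b]| = (#|T|)`!)%N.
Proof.
have E b' : #|[set s : {perm T} | s a == b']| = #|[set s : {perm T} | s a == b]|.
  rewrite -[RHS](card_imset _ (mulIg (tperm b b'))); apply: eq_card => s.
  rewrite inE; apply/eqP/imsetP => [sa|[u]].
    exists (s * tperm b b')%g; last by rewrite -mulgA tperm2 mulg1.
    by rewrite inE permM sa tpermR.
  by rewrite inE => /eqP ua ->; rewrite permM ua tpermL.
have <- : #|{perm T}| = (#|T|)`!.
  rewrite -cardsT -card_Sym; apply: eq_card => s; rewrite !inE.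
  by apply/esym/fintype.subsetP.
rewrite -[RHS]sum1_card (partition_big (fun s : {perm T} => s a) predT) //=.
rewrite (eq_bigr (fun=> #|[set s : {perm T} | s a == b]|)) ?sum_nat_const //.
by move=> i _; rewrite sum1_card -(E i); apply: eq_card => s; rewrite !inE.
Qed.

Lemma card_perm_at2 (a a' b b' : T) : a != a' -> b != b' ->
  (#|T| * (#|T|.-1 * #|[set s : {perm T} | (s a == b) && (s a' == b')]|)
   = (#|T|)`!)%N.
Proof.
move=> aa bb; rewrite -(card_perm_at a b); congr (_ * _)%N.
pose E c := [set s : {perm T} | (s a == b) && (s a' == c)].
have cE c : c != b -> #|E c| = #|E b'|.
  move=> cb; rewrite -[RHS](card_imset _ (mulIg (tperm b' c))).
  apply: eq_card => s.
  rewrite inE; apply/andP/imsetP => [[/eqP sa /eqP sa']|[u]].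
    exists (s * tperm b' c)%g; last by rewrite -mulgA tperm2 mulg1.
    by rewrite inE !permM sa sa' tpermR tpermD ?eqxx // eq_sym.
  rewrite inE => /andP[/eqP ua /eqP ua'] ->.
  by rewrite !permM ua ua' tpermL tpermD ?eqxx // eq_sym.
rewrite -[in RHS]sum1_card.
rewrite (partition_big (fun s : {perm T} => s a') (fun c => c != b)) /=.
  rewrite (eq_bigr (fun=> #|E b'|)) ?sum_nat_const.
    by rewrite -/(E b') -(cardC1 b).
  move=> c cb; rewrite -(cE _ cb) -sum1_card; apply: eq_bigl => s.
  by rewrite !inE.
move=> s; rewrite inE => /eqP <-.
by rewrite (inj_eq (@perm_inj _ s)) eq_sym.
Qed.


(** Two distinct arcs of A x A with distinct sources and distinct targets occur
together with probability 1 / (n (n - 1)), and two arcs that share exactly one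
end never do.  Hence the second moment is mu + (m (m - 1))^2 / (n (n - 1)), and
the second summand is at most mu^2 because m <= n. *)
Lemma inner_variance (R : realFieldType) A : (1 < #|T|)%N ->
  \sum_(s : {perm T}) (#|inner A s|%:R - #|A|%:R ^+ 2 / #|T|%:R) ^+ 2
    <= (#|T|)`!%:R * (#|A|%:R ^+ 2 / #|T|%:R) :> R.
Proof.
move=> T1; set N : R := (#|T|)`!%:R; set n : R := #|T|%:R.
set m : R := #|A|%:R; set mu := m ^+ 2 / n.
have n0 : n != 0 by rewrite pnatr_eq0 -lt0n ltnW.
have n1 : n - 1 != 0.
  by rewrite subr_eq0 /n -[1]/(1%:R) eqr_nat neq_ltn T1 orbT.
have nE : (#|T|.-1)%:R = n - 1 :> R by rewrite /n -{2}(prednK (ltnW T1)) -natr1 addrK.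
pose p2 a b a' b' : R := #|[set s : {perm T} | (s a == b) && (s a' == b')]|%:R.
have p1E a b : #|[set s : {perm T} | s a == b]|%:R = N / n.
  by rewrite /N -(card_perm_at a b) natrM mulrC mulKf.
have p2E a b a' b' : p2 a b a' b' =
    (a == a')%:R * (b == b')%:R * (N / n) +
    (a != a')%:R * (b != b')%:R * (N / (n * (n - 1))).
  rewrite /p2; have [->|aa] := eqVneq a a'; have [->|bb] := eqVneq b b'.
  - rewrite !mul1r !mul0r addr0 -(p1E a' b'); congr (_%:R).
    by apply: eq_card => s; rewrite !inE andbb.
  - rewrite mul1r !mul0r addr0; apply/eqP; rewrite pnatr_eq0 cards_eq0.
    apply/eqP/setP => s; rewrite !inE; apply/negP => /andP[/eqP -> bb'].
    by rewrite bb' in bb.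
  - rewrite mulr0 !mul0r addr0; apply/eqP; rewrite pnatr_eq0 cards_eq0.
    apply/eqP/setP => s; rewrite !inE; apply/negP => /andP[/eqP <-].
    by rewrite (inj_eq (@perm_inj _ s)) eq_sym (negbTE aa).
  - rewrite !mul0r add0r !mul1r /N -(card_perm_at2 aa bb) !natrM nE -/n.
    by rewrite mulrA mulrC mulKf // mulf_neq0.
have Y1 s : #|inner A s|%:R = \sum_(a in A) \sum_(b in A) (s a == b)%:R :> R.
  rewrite -sum1_card natr_sum big_mkcond /= [RHS]big_mkcond /=.
  apply: eq_bigr => a _; rewrite inE; case: ifP => [/andP[-> saA]|].
    rewrite (bigD1 (s a)) //= eqxx big1 ?addr0 // => b /andP[_].
    by rewrite eq_sym => /negbTE ->.
  case: (a \in A) => //= saA; rewrite big1 // => b bA.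
  by have /negbTE -> : s a != b by apply: contraFneq saA => ->.
have cnt (P : pred {perm T}) : \sum_s (P s)%:R = #|[set s | P s]|%:R :> R.
  rewrite -sum1_card natr_sum [RHS]big_mkcond /=; apply: eq_bigr => s _.
  by rewrite inE; case: (P s).
have sumA (x : R) : \sum_(a in A) x = m * x by rewrite sumr_const mulr_natl.
have E1 : \sum_s #|inner A s|%:R = N * mu :> R.
  under eq_bigr do rewrite Y1.
  rewrite exchange_big /=.
  rewrite (eq_bigr (fun=> \sum_(b in A) (N / n))).
    by rewrite !sumA /mu; field.
  move=> a _; rewrite exchange_big /=; apply: eq_bigr => b _.
  by rewrite cnt p1E.
have E2 : \sum_s #|inner A s|%:R ^+ 2 =
    N * mu + (m * (m - 1)) ^+ 2 * (N / (n * (n - 1))) :> R.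
  have -> : \sum_s #|inner A s|%:R ^+ 2 =
     \sum_(a in A) \sum_(b in A) \sum_(a' in A) \sum_(b' in A) p2 a b a' b'.
    have Y2 s : #|inner A s|%:R ^+ 2 = \sum_(a in A) \sum_(b in A)
        \sum_(a' in A) \sum_(b' in A) ((s a == b) && (s a' == b'))%:R :> R.
      rewrite expr2 {1}Y1 mulr_suml; apply: eq_bigr => a _.
      rewrite mulr_suml; apply: eq_bigr => b _.
      rewrite Y1 mulr_sumr; apply: eq_bigr => a' _.
      by rewrite mulr_sumr; apply: eq_bigr => b' _; rewrite -mulnb natrM.
    under eq_bigr do rewrite Y2.
    rewrite exchange_big; apply: eq_bigr => a _.
    rewrite exchange_big; apply: eq_bigr => b _.
    rewrite exchange_big; apply: eq_bigr => a' _.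
    by rewrite exchange_big; apply: eq_bigr => b' _; rewrite cnt.
  have eq1 x : x \in A -> \sum_(y in A) (x == y)%:R = 1 :> R.
    move=> xA; rewrite (bigD1 x) //= eqxx big1 ?addr0 // => y /andP[_].
    by rewrite eq_sym => /negbTE ->.
  have neq1 x : x \in A -> \sum_(y in A) (x != y)%:R = m - 1 :> R.
    move=> xA.
    suff <- : \sum_(y in A) (x == y)%:R + \sum_(y in A) (x != y)%:R = m :> R.
      by rewrite eq1 // addrAC subrr add0r.
    rewrite -big_split -[m]mulr1 -sumA; apply: eq_bigr => y _.
    by case: (x == y); rewrite /= ?add0r ?addr0.
  rewrite (eq_bigr (fun=> \sum_(b in A)
    (N / n + (m - 1) ^+ 2 * (N / (n * (n - 1)))))).
    rewrite !sumA /mu; field.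
    by rewrite n0 n1.
  move=> a aA; apply: eq_bigr => b bA.
  rewrite (eq_bigr (fun a' => (a == a')%:R * (N / n) +
      (a != a')%:R * ((m - 1) * (N / (n * (n - 1)))))).
    by rewrite big_split /= -!mulr_suml eq1 // neq1 // mul1r expr2 mulrA.
  move=> a' _; under eq_bigr do rewrite p2E.
  by rewrite big_split /= -!mulr_suml -!mulr_sumr eq1 // neq1 // mulr1 !mulrA.
have -> : \sum_s (#|inner A s|%:R - mu) ^+ 2 =
    \sum_s #|inner A s|%:R ^+ 2 - 2 * mu * \sum_s #|inner A s|%:R
      + N * mu ^+ 2 :> R.
  have -> : N = \sum_(s : {perm T}) 1.
    rewrite sumr_const; congr (_%:R); rewrite -cardsT -card_Sym.
    by apply: eq_card => s; rewrite !inE; apply/fintype.subsetP.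
  rewrite mulr_sumr mulr_suml -sumrB -big_split /=.
  by apply: eq_bigr => s _; ring.
rewrite E1 E2.
have N0 : 0 <= N by exact: ler0n.
have ngt1 : 1 < n by rewrite /n ltr1n.
have ngt0 : 0 < n by apply: lt_trans ngt1.
have mn : m <= n by rewrite /m ler_nat max_card.
suff key : (m * (m - 1)) ^+ 2 / (n * (n - 1)) <= mu ^+ 2.
  have := ler_wpM2l N0 key.
  by rewrite (mulrC _ (N / _)) -mulrA (mulrC _ (_ ^+ 2)); lra.
rewrite ler_pdivrMr ?mulr_gt0 ?subr_gt0 //.
have -> : mu ^+ 2 * (n * (n - 1)) = m ^+ 2 * (m ^+ 2 * (n - 1)) / n.
  by rewrite /mu; field.
rewrite ler_pdivlMr // exprMn -mulrA.
have [A0|m0] := posnP #|A|; first by rewrite /m A0 !expr0n /= !mul0r.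
have m1 : 1 <= m by rewrite /m ler1n.
rewrite ler_wpM2l ?sqr_ge0 // -subr_ge0.
rewrite (_ : _ - _ = m * (n - m) + n * (m - 1)); last by ring.
by rewrite addr_ge0 // mulr_ge0 ?subr_ge0 // ltW // (lt_le_trans _ m1).
Qed.

End Inner.

(** * The proportion of permutations without short cycles *)

Section LongCycles.
Variable T : finType.
Implicit Types (S : {set T}) (s u w : {perm T}).

Definition long_on S s := [forall x in S, (s x != x) && (s (s x) != x)].

Lemma long_cyclesE s : long_cycles s = long_on finset.setT s.
Proof.
apply/forallP/forall_inP => [ls x _|ls x].
  have po y i : (s ^+ i)%g y \in porbit s y by exact: mem_porbit.
  apply/andP; split; apply: contraTN (ls x) => /eqP sx; rewrite -ltnNge ltnS.
    apply: (@leq_trans #|[set x]|); last by rewrite cards1.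
    apply/subset_leq_card/fintype.subsetP => y /porbitP[i ->]; rewrite inE.
    by elim: i => [|i ih]; rewrite ?perm1 // expgSr permM (eqP ih) sx.
  apply: (@leq_trans #|[set x; s x]|); last by rewrite cards2 ltnS leq_b1.
  apply/subset_leq_card/fintype.subsetP => y /porbitP[i ->].
  elim: i => [|i]; first by rewrite perm1 !inE eqxx.
  by rewrite expgSr permM !inE => /orP[]/eqP->; rewrite ?sx eqxx ?orbT.
have /andP[s1 s2] := ls x (finset.in_setT x).
apply: (@leq_trans #|[set x; s x; s (s x)]|).
  rewrite -finset.setUA !cardsU1 cards1 !inE negb_or eq_sym s1 eq_sym s2.
  by rewrite (inj_eq (@perm_inj _ s)) eq_sym s1.
apply/subset_leq_card/fintype.subsetP => y; rewrite !inE.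
by case/orP => [/orP[]|]/eqP->; apply/porbitP; [exists 0%N|exists 1%N|exists 2%N];
  rewrite permX.
Qed.

Definition long_perms S := [set s in Sym S | long_on S s].

(** Splicing b into a cycle of length at least 3 makes a cycle of length at
least 4. *)
Lemma long_on_insert S b c u : b \notin S -> c \in S -> u \in Sym S ->
  long_on S u -> long_on (b |: S) (tperm b c * u)%g.
Proof.
move=> bS cS uS /forall_inP lu; have cb := insert_neq bS cS.
have sb := insert_b b c u; have sc := insert_c c bS uS.
have sD := @insertD _ b c u.
have ub : u b = b by apply: Sym_out uS bS.
have uc : u c != b by apply: contraNneq bS => <-; rewrite (Sym_closed _ uS).
set s := (tperm b c * u)%g in sb sc sD *.
have /andP[uc1 uc2] := lu c cS.
apply/forall_inP => x /setU1P[->|xS].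
  by rewrite sb uc /= sD // -[X in _ != X]ub (inj_eq (@perm_inj _ u)).
have xb : x != b by apply: contraNneq bS => <-.
have [->|xc] := eqVneq x c; first by rewrite sc eq_sym cb sb uc1.
rewrite sD //; have /andP[ux1 ux2] := lu x xS; rewrite ux1 /=.
have uxb : u x != b by rewrite -[X in _ != X]ub (inj_eq (@perm_inj _ u)).
have [->|uxc] := eqVneq (u x) c; first by rewrite sc eq_sym.
by rewrite sD.
Qed.

(** Splicing b into a 2-cycle makes a 3-cycle. *)
Lemma long_on_insert3 S b c u : b \notin S -> c \in S -> u \in Sym S ->
  u c != c -> u (u c) = c -> long_on (S :\ c :\ u c) u ->
  long_on (b |: S) (tperm b c * u)%g.
Proof.
move=> bS cS uS uc uuc /forall_inP lu; have cb := insert_neq bS cS.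
have sb := insert_b b c u; have sc := insert_c c bS uS.
have sD := @insertD _ b c u.
have ub : u b = b by apply: Sym_out uS bS.
have ucb : u c != b by apply: contraNneq bS => <-; rewrite (Sym_closed _ uS).
set s := (tperm b c * u)%g in sb sc sD *.
apply/forall_inP => x /setU1P[->|xS].
  by rewrite sb ucb /= sD // uuc.
have xb : x != b by apply: contraNneq bS => <-.
have [->|xc] := eqVneq x c; first by rewrite sc eq_sym cb sb uc.
have [->|xuc] := eqVneq x (u c).
  by rewrite sD // uuc eq_sym uc sc eq_sym.
have xI : x \in S :\ c :\ u c by rewrite !inE xuc xc.
rewrite sD //; have /andP[ux1 ux2] := lu x xI; rewrite ux1 /= sD //.
  by rewrite -[X in _ != X]ub (inj_eq (@perm_inj _ u)).
by rewrite -[X in _ != X]uuc (inj_eq (@perm_inj _ u)).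
Qed.

Lemma SymS S S' : S \subset S' -> Sym S \subset Sym S'.
Proof.
move=> SS; apply/fintype.subsetP => s; rewrite !mem_Sym => sS.
exact: fintype.subset_trans sS SS.
Qed.

Lemma card_long_perms S : #|long_perms S| = (\sum_(s in Sym S) long_on S s)%N.
Proof.
rewrite -sum1_card [RHS]big_mkcond [LHS]big_mkcond /=; apply: eq_bigr => s _.
by rewrite [in LHS]inE; case: (s \in _); case: (long_on _ _).
Qed.

(** Choosing the partner d of c and a permutation of the rest without short
cycles gives the permutations whose only short cycle is a 2-cycle through c. *)
Lemma long_perms2 S c : c \in S ->
  (\sum_(d in S :\ c) #|long_perms (S :\ c :\ d)| <=
   \sum_(u in Sym S)
     [&& u c != c, u (u c) == c & long_on (S :\ c :\ u c) u])%N.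
Proof.
move=> cS; have cS' : c \notin S :\ c by rewrite !inE eqxx.
rewrite -{3}(finset.setD1K cS) sum_Sym_insert //.
rewrite [leqRHS](bigID (fun d => d \in S :\ c)) /= -[leqLHS]addn0 leq_add //.
rewrite [leqLHS]big_mkcond [leqRHS]big_mkcond /=; apply: leq_sum => d _.
case: ifP => dS //; rewrite inE dS orbT /=.
rewrite card_long_perms [leqRHS](bigID (fun w => w \in Sym (S :\ c :\ d))) /=.
rewrite -[leqLHS]addn0 leq_add //.
rewrite [leqLHS]big_mkcond [leqRHS]big_mkcond /=; apply: leq_sum => w _.
case: ifP => wS //; rewrite (fintype.subsetP (SymS (subsetDl _ _)) _ wS) /=.
case: (boolP (long_on _ w)) => // /forall_inP lw.
have dc : d != c by move: dS; rewrite !inE => /andP[].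
have wc : w c = c by apply: Sym_out wS _; rewrite !inE eqxx andbF.
have wd : w d = d by apply: Sym_out wS _; rewrite !inE eqxx.
have -> : (tperm c d * w)%g c = d by rewrite permM tpermL.
have -> : (tperm c d * w)%g d = c by rewrite permM tpermR.
rewrite dc eqxx /= lt0b; apply/forall_inP => x xS.
have wE y : y \in S :\ c :\ d -> (tperm c d * w)%g y = w y.
  rewrite !inE => /and3P[yd yc _].
  by rewrite permM tpermD // eq_sym.
by rewrite !wE ?lw // (Sym_closed _ wS).
Qed.

(** The first summand counts the ways in which b lies in a cycle of length at
least 4, the second those in which it lies in the 3-cycle of b, c, d.  They are
told apart by whether u (u c) = c, where u is s with b removed. *)
Lemma long_perms_rec S b : b \notin S ->
  (\sum_(c in S) (#|long_perms S| + \sum_(d in S :\ c) #|long_perms (S :\ c :\ d)|)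
    <= #|long_perms (b |: S)|)%N.
Proof.
move=> bS; rewrite (card_long_perms (b |: S)) sum_Sym_insert // big_setU1 //=.
apply: leq_trans (leq_addl _ _); apply: leq_sum => c cS.
apply: leq_trans (leq_add (leqnn _) (long_perms2 cS)) _.
rewrite card_long_perms -big_split /=; apply: leq_sum => u uS.
case: (boolP (long_on S u)) => [lu|_].
  rewrite (long_on_insert bS cS uS lu).
  by have /andP[_ /negbTE ->] := forall_inP lu c cS; rewrite andbF.
by case: and3P => // -[uc /eqP uuc lu]; rewrite (long_on_insert3 bS cS uS uc uuc lu).
Qed.

(** For n >= 2 this reads f (n + 1) = n f n + n (n - 1) f (n - 2), which is
[long_perms_rec] for sets of size n + 1. *)
Fixpoint long_lb n := match n with
  | 0 => 1
  | n1.+1 => n1 * long_lb n1 +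
      (if n1 is (n3.+1).+1 then n1 * (n1.-1 * long_lb n3) else 0)
  end%N.

Lemma long_lb_le S : (long_lb #|S| <= #|long_perms S|)%N.
Proof.
have [k] := ubnP #|S|; elim: k S => // k ih S.
have [->|] := set_0Vmem S.
  move=> _; rewrite cards0 /= card_gt0; apply/set0Pn; exists 1%g.
  by rewrite inE group1; apply/forall_inP => x; rewrite inE.
move=> [b bS]; rewrite -(finset.setD1K bS); set S' := S :\ b.
have bS' : b \notin S' by rewrite !inE eqxx.
rewrite cardsU1 bS' add1n ltnS => lek.
apply: leq_trans (long_perms_rec bS').
have lb c : c \in S' -> (long_lb #|S'| +
     (if #|S'| is n3.+2 then #|S'|.-1 * long_lb n3 else 0) <=
     #|long_perms S'| + \sum_(d in S' :\ c) #|long_perms (S' :\ c :\ d)|)%N.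
  move=> cS; apply: leq_add; first exact: ih.
  case E: #|S'| => [|[|n3]] //.
  have cE : #|S' :\ c| = n3.+1 by have := cardsD1 c S'; rewrite cS E; lia.
  rewrite /= -{1}cE -sum_nat_const leq_sum // => d dS.
  have dE : #|S' :\ c :\ d| = n3.
    by have := cardsD1 d (S' :\ c); rewrite dS cE; lia.
  by rewrite -{1}dE ih // dE; lia.
apply: leq_trans; last by apply: leq_sum => c cS; exact: lb cS.
rewrite sum_nat_const mulnDr /= leq_add2l.
by case: #|S'| => [|[|n]] //.
Qed.

(** The values at 3, 4 and 5 are 2, 6 and 24, so the constant 5 is sharp at 5.
From there on f n / n! is an average of earlier values, since
n a_n = (n - 1) a_(n-1) + a_(n-3). *)
Lemma fact_long_lb n : (2 < n)%N -> (n`! <= 5 * long_lb n)%N.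
Proof.
have [k] := ubnP n; elim: k n => // k ih n.
case: n => [|[|[|[|[|[|n]]]]]] // lek _.
have h1 := ih n.+4.+1 lek isT; have h3 := ih n.+3 (ltac:(lia)) isT.
change (long_lb n.+4.+2) with
  (n.+4.+1 * long_lb n.+4.+1 + n.+4.+1 * (n.+4 * long_lb n.+3))%N.
have -> : ((n.+4.+2)`! = n.+4.+1 * (n.+4.+1)`! + n.+4.+1 * (n.+4 * (n.+3)`!))%N.
  by rewrite (factS n.+4.+1) mulSn addnC (factS n.+4) (factS n.+3).
rewrite mulnDr; apply: leq_add.
  by rewrite (mulnCA 5%N) leq_mul2l h1 orbT.
by rewrite (mulnCA 5%N) (mulnCA 5%N (n.+4)) !leq_mul2l h3 !orbT.
Qed.

Lemma card_long_cycles : (2 < #|T|)%N ->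
  ((#|T|)`! <= 5 * #|[set s : {perm T} | long_cycles s]|)%N.
Proof.
move=> T2; apply: leq_trans (fact_long_lb T2) _; rewrite leq_mul2l /=.
rewrite -cardsT; apply: leq_trans (long_lb_le _) _.
apply/subset_leq_card/fintype.subsetP => s; rewrite !inE long_cyclesE.
by case/andP.
Qed.
End LongCycles.

(** * Edge counting for a Hamilton cycle *)

Section NonHamiltonian.
Variable T : finType.
Implicit Types (A : {set T}) (s : {perm T}).

Definition crossing_edges A : {set {set T}} :=
  [set [set p.1; p.2] | p in finset.setX A (~: A)].

Lemma crossing_edges_simple A : simple_edges (crossing_edges A).
Proof.
apply/forall_inP => e /imsetP[[x y]]; rewrite !inE /= => /andP[xA yA] ->.
by rewrite cards2; have -> : x != y by apply: contraNneq yA => <-.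
Qed.

Definition crossing A : sgraph T := SGraph (crossing_edges_simple A).

Lemma adj_crossing A x y : adj (crossing A) x y = (x \in A) (+) (y \in A).
Proof.
rewrite /adj /=; apply/imsetP/idP => [[[u v]]|].
  rewrite !inE /= => /andP[uA vA] e.
  have : x \in [set u; v] by rewrite -e !inE eqxx.
  have : y \in [set u; v] by rewrite -e !inE eqxx orbT.
  have : u \in [set x; y] by rewrite e !inE eqxx.
  have : v \in [set x; y] by rewrite e !inE eqxx orbT.
  rewrite !inE => vxy uxy /orP[]/eqP yE /orP[]/eqP xE; subst x y.
  - by move: vxy vA; rewrite orbb => /eqP ->; rewrite uA.
  - by rewrite uA (negbTE vA).
  - by rewrite uA (negbTE vA).
  - by move: uxy vA; rewrite orbb => /eqP <-; rewrite uA.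
case: (boolP (x \in A)) => xA yA.
  by exists (x, y) => //; rewrite !inE xA.
by exists (y, x); rewrite ?inE /= ?xA ?andbT // finset.setUC.
Qed.

Lemma degree_crossing A x :
  degree (crossing A) x = if x \in A then #|~: A| else #|A|.
Proof.
rewrite /degree; case: ifP => xA; apply: eq_card => y;
  by rewrite !inE adj_crossing xA.
Qed.

Lemma crossing_min_degree A : (#|A| <= #|~: A|)%N ->
  (#|A| <= min_degree (crossing A))%N.
Proof.
move=> leA; rewrite /min_degree; elim/big_ind: _ => [|x y|x _].
- exact: max_card.
- by rewrite leq_min => -> ->.
- by rewrite degree_crossing; case: ifP.
Qed.

Lemma adj_cycle_graph s x y :
  adj (cycle_graph s) x y -> (y == s x) || (x == s y).
Proof.
rewrite /adj /= => /imsetP[w]; rewrite inE => sw e.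
have : x \in [set w; s w] by rewrite -e !inE eqxx.
have : y \in [set w; s w] by rewrite -e !inE eqxx orbT.
have : w \in [set x; y] by rewrite e !inE eqxx.
have : s w \in [set x; y] by rewrite e !inE eqxx orbT.
rewrite !inE => swxy wxy /orP[]/eqP yE /orP[]/eqP xE; subst x y.
- by move: swxy; rewrite orbb (negbTE sw).
- by rewrite eqxx orbT.
- by rewrite eqxx.
- by move: wxy; rewrite orbb eq_sym (negbTE sw).
Qed.

(** s has exactly #|A| arcs that end in A. *)
Lemma inner_split A s : (#|inner A s| + #|[set x in ~: A | s x \in A]| = #|A|)%N.
Proof.
have -> : #|A| = #|[set x | s x \in A]|.
  rewrite -(card_imset _ (@perm_inj _ s^-1)); apply: eq_card => x.
  rewrite inE; apply/imsetP/idP => [[y yA ->]|sxA]; first by rewrite permKV.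
  by exists (s x); rewrite ?permK.
rewrite -cardsUI [X in (_ + #|pred_of_set X|)%N](_ : _ = finset.set0).
  rewrite cards0 addn0; apply: eq_card => x; rewrite !inE.
  by case: (x \in A); rewrite ?orbF.
by apply/setP => x; rewrite !inE; case: (x \in A) => //; rewrite andbF.
Qed.

(** The arcs inside B of the Hamilton cycle, given by their sources [EH], are
matched injectively by [phi] with arcs of s inside B, given by [EF].  Every
cycle of s avoiding A contains an arc missed by [phi]: if all of its edges were
used, it would be closed under the successor map f of the Hamilton cycle, and so
would contain every vertex, including those of A. *)
Lemma hamiltonian_avoiding_le_inner A s : long_cycles s -> A != finset.set0 ->
  hamiltonian (gunion (crossing A) (cycle_graph s)) ->
  (#|avoiding A s| <= #|inner A s|)%N.
Proof.
move=> ls /set0Pn[a0 a0A] [c [c3 /andP[cyc uc] allc]].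
pose f := next c.
have fI : injective f := can_inj (prev_next uc).
have closed (O : {set T}) x : x \in O ->
    (forall y, y \in O -> f y \in O) -> forall z, z \in O.
  move=> xO fO z; have := fconnect_cycle (cycle_next uc) (allc x) z.
  rewrite allc => /iter_findex <-.
  by elim: (findex _ _ _) => //= i; apply: fO.
have ff x : f (f x) != x.
  apply: contraTneq c3 => ffx; rewrite -ltnNge ltnS -(card_uniqP uc).
  apply: (@leq_trans #|[set x; f x]|); last by rewrite cards2 ltnS leq_b1.
  apply/subset_leq_card/fintype.subsetP => z _.
  apply: (closed _ x); first by rewrite !inE eqxx.
  by move=> y; rewrite !inE => /orP[]/eqP->; rewrite ?ffx eqxx ?orbT.
have ls2 x : s (s x) != x.
  by move: ls; rewrite long_cyclesE => /forall_inP/(_ x (finset.in_setT x))/andP[].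
pose EH := [set x in ~: A | f x \in ~: A].
pose EF := [set x in ~: A | s x \in ~: A].
have EHF x : x \in EH -> (f x == s x) || (x == s (f x)).
  rewrite !inE => /andP[xA fxA]; apply: adj_cycle_graph.
  have := next_cycle cyc (allc x); rewrite /adj /= inE => /orP[|//].
  by rewrite -[_ \in _]/(adj (crossing A) x (f x)) adj_crossing (negbTE xA)
    (negbTE fxA).
(* An edge of the Hamilton cycle may traverse an arc of s in either direction;
   phi picks the source of that arc. *)
pose phi x := if f x == s x then x else f x.
have phiE x : x \in EH -> [set phi x; s (phi x)] = [set x; f x].
  move=> xE; rewrite /phi; case: eqP => [<- //|fs].
  by have /orP[/eqP //|/eqP <-] := EHF x xE; rewrite finset.setUC.
have phiI : {in EH &, injective phi}.
  move=> x y xE yE e; have := phiE x xE; rewrite e phiE // => e2.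
  have : x \in [set y; f y] by rewrite e2 !inE eqxx.
  have : y \in [set x; f x] by rewrite -e2 !inE eqxx.
  rewrite !inE => /orP[/eqP //|/eqP yfx] /orP[/eqP //|/eqP xfy].
  by have := ff x; rewrite -yfx -xfy eqxx.
have phiF : phi @: EH \subset EF.
  apply/fintype.subsetP => _ /imsetP[x xE ->].
  have: [set phi x; s (phi x)] \subset ~: A.
    rewrite phiE //; apply/fintype.subsetP => z.
    by move: xE; rewrite !inE => /andP[xA fxA] /orP[]/eqP->.
  by move/fintype.subsetP => sub; rewrite inE !sub // !inE eqxx ?orbT.
pose D := EF :\: phi @: EH.
have missed O : O \in avoiding A s -> O \in porbit s @: D.
  rewrite inE => /andP[/imsetP[x _ ->]] dis.
  have OA y : y \in porbit s x -> y \notin A.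
    by move=> yx; rewrite (disjointFr dis yx).
  have sO y : y \in porbit s x -> s y \in porbit s x.
    rewrite -!eq_porbit_mem => /eqP <-.
    by rewrite eq_porbit_mem -{1}(expg1 s) mem_porbit.
  have tO y : y \in porbit s x -> (s^-1)%g y \in porbit s x.
    rewrite -!eq_porbit_mem => /eqP <-.
    by rewrite eq_porbit_mem -porbitV -{1}(expg1 s^-1) mem_porbit.
  have [/existsP[y /andP[yx yD]]|/existsPn noD] :=
    boolP [exists y, (y \in porbit s x) && (y \in D)].
    by apply/imsetP; exists y => //; apply/esym/eqP; rewrite eq_porbit_mem.
  have inphi y : y \in porbit s x -> (s y == f y) || (y == f (s y)).
    move=> yx; have := noD y; rewrite yx /= !inE OA // OA ?sO //= andbT negbK.
    move=> /imsetP[z zE yE].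
    have := EHF z zE; move: yE; rewrite /phi; case: eqP => [fz -> _|_ ->].
      by rewrite -fz eqxx.
    by move=> /= /eqP zE'; rewrite -zE' eqxx orbT.
  (* Both s-neighbours of y are f-neighbours of y.  As they are distinct and y
     has only two f-neighbours, f y is one of them. *)
  have fO y : y \in porbit s x -> f y \in porbit s x.
    move=> yx; have /orP[/eqP <-|/eqP sy] := inphi y yx; first exact: sO.
    have /orP[|/eqP ty] := inphi _ (tO y yx).
      rewrite permKV => /eqP yE; have : s y = (s^-1)%g y by apply: fI; rewrite -sy.
      by move=> e; have := ls2 y; rewrite e permKV eqxx.
    by rewrite permKV in ty; rewrite -ty tO.
  by have := OA a0 (closed _ _ (porbit_id s x) fO a0); rewrite a0A.
have cD : (#|avoiding A s| <= #|D|)%N.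
  apply: leq_trans (leq_imset_card (porbit s) D).
  by apply/subset_leq_card/fintype.subsetP.
have cF : (#|EF| + #|[set x in ~: A | s x \in A]| = #|~: A|)%N.
  rewrite -(cardsID [set x | s x \in ~: A] (~: A)); congr (_ + _)%N;
  by apply: eq_card => x; rewrite !inE // negbK andbC.
have cH : (#|~: A| <= #|EH| + #|A|)%N.
  rewrite -(cardsID [set x | f x \in ~: A] (~: A)); apply: leq_add.
    by apply: subset_leq_card; apply/fintype.subsetP => x; rewrite !inE.
  rewrite -(card_imset _ fI); apply/subset_leq_card/fintype.subsetP => y /imsetP[x + ->].
  by rewrite !inE negbK => /andP[].
have cphi : #|phi @: EH| = #|EH| by rewrite card_in_imset.
have := cardsD EF (phi @: EH); rewrite -/D (finset.setIidPr phiF) cphi.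
have := subset_leq_card phiF; rewrite cphi; have := inner_split A s.
by lia.
Qed.

End NonHamiltonian.

(** * The exceptional probability *)

Section Probability.
Variables (R : realType) (T : finType) (A : {set T}).
Let m : R := #|A|%:R.
Let n : R := #|T|%:R.
Let mu : R := m ^+ 2 / n.

(** Chebyshev's inequality.  Where X <= Y, the number h - mu is at most
(h - X) + (Y - mu), and the mean square of this sum is at most twice the sum of
the two variances. *)
Lemma card_avoiding_le_inner (h : R) : (1 < #|T|)%N ->
  h = \sum_(#|A| <= i < #|T|) i.+1%:R^-1 -> mu < h ->
  #|[set s : {perm T} | (#|avoiding A s| <= #|inner A s|)%N]|%:R
    <= (#|T|)`!%:R * (2 * (h + mu) / (h - mu) ^+ 2).
Proof.
move=> T1 hE muh; set N : R := (#|T|)`!%:R.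
have d0 : 0 < (h - mu) ^+ 2 by rewrite exprn_gt0 // subr_gt0.
rewrite mulrA ler_pdivlMr //.
have SymT (s : {perm T}) : s \in Sym finset.setT.
  by rewrite mem_Sym; apply/fintype.subsetP.
have := avoiding_variance R (finset.subsetT A).
rewrite /= cardsT -hE finset.setCT cards0.
rewrite (eq_bigl predT) => [varX|s]; last by rewrite SymT.
have varY := inner_variance R A T1; rewrite -/m -/n -/mu -/N in varX varY.
apply: le_trans (_ : \sum_(s : {perm T})
   (2 * (#|avoiding A s|%:R - 0 - h) ^+ 2 + 2 * (#|inner A s|%:R - mu) ^+ 2) <= _).
  rewrite mulr_natl -sumr_const [leLHS]big_mkcond /=; apply: ler_sum => s _.
  have sq2 (x : R) : 0 <= 2 * x ^+ 2 by rewrite mulr_ge0 ?sqr_ge0.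
  rewrite inE; case: ifP => [le|_]; last by rewrite addr_ge0.
  set X : R := #|avoiding A s|%:R; set Y : R := #|inner A s|%:R.
  have XY : X <= Y by rewrite /X /Y ler_nat.
  rewrite subr0; apply: (@le_trans _ _ (((h - X) + (Y - mu)) ^+ 2)).
    by rewrite ler_sqr ?nnegrE; lra.
  rewrite -subr_ge0 (_ : _ - _ = ((h - X) - (Y - mu)) ^+ 2) ?sqr_ge0 //; ring.
rewrite big_split /= -!mulr_sumr; lra.
Qed.

(** The exceptional permutations are at most a fraction 2 (h + mu) / (h - mu)^2
of all permutations, and the conditioning costs a factor 5. *)
Lemma crossing_Gn2_pr (h : R) : (2 < #|T|)%N -> A != finset.set0 ->
  h = \sum_(#|A| <= i < #|T|) i.+1%:R^-1 -> mu < h ->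
  1 - 10 * (h + mu) / (h - mu) ^+ 2 <=
    Gn2_pr R (fun F => ~ hamiltonian (gunion (crossing A) F)).
Proof.
move=> T2 A0 hE muh; have few := card_avoiding_le_inner (ltnW T2) hE muh.
rewrite /Gn2_pr; set good := [set s | long_cycles s && _].
set L := [set s | long_cycles s].
set B := [set s : {perm T} | (#|avoiding A s| <= #|inner A s|)%N] in few.
set q := (h + mu) / (h - mu) ^+ 2.
have many : (#|T|)`!%:R <= 5 * #|L|%:R :> R.
  by rewrite -natrM ler_nat card_long_cycles.
have L0 : 0 < #|L|%:R :> R.
  have : 0 < (#|T|)`!%:R :> R by rewrite ltr0n fact_gt0.
  lra.
have LB : #|L|%:R <= #|good|%:R + #|B|%:R :> R.
  rewrite -natrD ler_nat; apply: leq_trans (leq_card_setU _ _).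
  apply/subset_leq_card/fintype.subsetP => s; rewrite !inE => ls; rewrite ls /=.
  have [le|lt] := boolP (#|avoiding A s| <= #|inner A s|)%N.
    by rewrite orbT.
  rewrite orbF; apply/asboolP => ham; move: lt.
  by rewrite (hamiltonian_avoiding_le_inner ls A0 ham).
have q0 : 0 <= q.
  have mu0 : 0 <= mu by rewrite divr_ge0 ?exprn_ge0 ?ler0n.
  by rewrite divr_ge0 ?sqr_ge0 // addr_ge0 // ltW // (le_lt_trans mu0).
rewrite ler_pdivlMr // -mulrA -/q.
have := ler_wpM2r q0 many.
rewrite -mulrA -/q in few; lra.
Qed.

End Probability.

(** * Asymptotics *)

Section Asymptotics.
Variable R : realType.

Lemma harmonic_ge_ln m n : (m <= n)%N ->
  ln n.+1%:R - ln m.+1%:R <= \sum_(m <= i < n) i.+1%:R^-1 :> R.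
Proof.
move=> mn; rewrite -(telescope_sumr (fun i => ln i.+1%:R : R)) //.
apply: ler_sum => i _.
have i0 : 0 < i.+1%:R :> R by rewrite ltr0n.
rewrite -ln_div ?posrE ?ltr0n //.
have -> : i.+2%:R / i.+1%:R = 1 + i.+1%:R^-1 :> R.
  by rewrite -(natr1 i.+1) mulrDl divff ?gt_eqF // mul1r.
by apply: le_ln1Dx; rewrite (lt_trans _ (_ : 0 < _)) ?invr_gt0 // ltrN10.
Qed.

Lemma ln_le_sqrt (x : R) : 0 < x -> ln x <= 2 * Num.sqrt x.
Proof.
move=> x0; have s0 : 0 < Num.sqrt x by rewrite sqrtr_gt0.
rewrite -{1}(sqr_sqrtr (ltW x0)) lnXn // -[leLHS]mulr_natl.
by rewrite ler_wpM2l // ltW // ln_sublinear.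
Qed.

(** All requirements on n follow from ln n >= 32 / e^2.  It gives e q >= 4, so
that the rounding of (1 - e) q up to an integer m is absorbed by the slack
between (1 - e)^2 q^2 and (1 - e) q^2, and m + 1 <= q.  It also gives
ln ln n <= (e / 2) ln n, so that
2 ln (m + 1) <= ln (q^2) <= ln n + ln ln n <= (1 + e / 2) ln n. *)
Lemma small_side_bounds (e : R) n m : 0 < e <= 2^-1 -> 32 / e ^+ 2 <= ln n%:R ->
  let q := Num.sqrt (n%:R * ln n%:R / 2) in
  m%:R <= (1 - e) * q + 1 ->
  [/\ (2 < n)%N, (m + m <= n)%N, m%:R ^+ 2 / n%:R <= (1 - e) / 2 * ln n%:R &
      ln m.+1%:R <= (2^-1 + e / 4) * ln n%:R].
Proof.
move=> /andP[e0 e2] /=; set L := ln n%:R => LE.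
set q := Num.sqrt _ => mq.
have e20 : 0 < e ^+ 2 by rewrite exprn_gt0.
have L128 : 128 <= L.
  apply: le_trans LE; rewrite ler_pdivlMr //.
  have : e ^+ 2 <= 2^-1 ^+ 2 by rewrite lerXn2r ?nnegrE //; lra.
  lra.
have n0 : 0 < n%:R :> R.
  rewrite lt_neqAle ler0n andbT; apply: contraTneq L128 => n0.
  by rewrite /L -n0 ln0 // -ltNge.
have nL : L < n%:R by apply: ln_sublinear.
have n128 : 128 < n%:R :> R by lra.
have q2 : q ^+ 2 = n%:R * L / 2.
  by rewrite sqr_sqrtr // divr_ge0 // mulr_ge0 //; lra.
have q0 : 0 <= q by exact: sqrtr_ge0.
have eq4 : 4 <= e * q.
  have e0' : 0 <= e by lra.
  rewrite -ler_sqr ?nnegrE ?mulr_ge0 // exprMn q2.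
  move: LE; rewrite ler_pdivrMr //; nra.
have q8 : 8 <= q by nra.
have m1q : m.+1%:R <= q by rewrite -natr1; lra.
have Ln4 : L <= n%:R / 2.
  apply: le_trans (ln_le_sqrt n0) _.
  set z := Num.sqrt _; have z2 : z ^+ 2 = n%:R by rewrite sqr_sqrtr // ltW.
  have z0 : 0 <= z by exact: sqrtr_ge0.
  have z4 : 4 <= z by nra.
  by rewrite -z2; nra.
have qn : q <= n%:R / 2.
  rewrite -ler_sqr ?nnegrE //.
  by rewrite q2; nra.
split.
- by rewrite -(ltr_nat R); lra.
- by rewrite -(ler_nat R) natrD; move: m1q; rewrite -natr1; lra.
- rewrite ler_pdivrMr // [leRHS](_ : _ = (1 - e) * q ^+ 2); last by rewrite q2; field.
  apply: le_trans (_ : ((1 - e) * q + 1) ^+ 2 <= _).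
    by rewrite lerXn2r ?nnegrE ?ler0n //; nra.
  nra.
have sqE : ln (m.+1%:R ^+ 2) <= ln (n%:R * L) :> R.
  rewrite ler_ln ?posrE ?exprn_gt0 ?ltr0n ?mulr_gt0 //; try lra.
  apply: le_trans (_ : q ^+ 2 <= _).
    by rewrite lerXn2r ?nnegrE ?ler0n.
  by rewrite q2; nra.
have lnL : ln L <= e / 2 * L.
  have L0 : 0 < L by lra.
  apply: le_trans (ln_le_sqrt L0) _; set z := Num.sqrt _.
  have z2 : z ^+ 2 = L by rewrite sqr_sqrtr // ltW.
  have z0 : 0 <= z by exact: sqrtr_ge0.
  suff ez : 4 <= e * z by rewrite -z2; nra.
  rewrite -ler_sqr ?nnegrE ?mulr_ge0 //; last exact: ltW.
  rewrite exprMn z2; move: LE; rewrite ler_pdivrMr //; lra.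
move: sqE; rewrite lnXn ?ltr0n // lnM ?posrE //; last by lra.
rewrite -[leLHS]mulr_natl -/L; lra.
Qed.

Local Open Scope classical_set_scope.

Lemma cvg_const_div_ln (C : R) : 0 <= C -> (C / ln n%:R) @[n --> \oo] --> (0 : R).
Proof.
move=> C0; apply/cvgr0Pnorm_le => d d0; near=> n.
have nE : expR (C / d + 1) <= n%:R by near: n; apply: nbhs_infty_ger.
have n0 : 0 < n%:R :> R by apply: lt_le_trans nE; apply: expR_gt0.
have Ln : C / d + 1 <= ln n%:R by rewrite -[leLHS]expRK ler_ln ?posrE ?expR_gt0.
have L0 : 0 < ln n%:R :> R.
  by apply: lt_le_trans Ln; rewrite ltr_wpDl ?divr_ge0 // ltW.
rewrite ger0_norm ?divr_ge0 // ?(ltW L0) // ler_pdivrMr // mulrC -ler_pdivrMr //.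
lra.
Unshelve. all: by end_near. Qed.

End Asymptotics.

Local Open Scope classical_set_scope.


Theorem theorem1p2 (R : realType) (eps : R) (heps : 0 < eps) :
  exists (n0 : nat) (r : nat -> R),
    r n @[n --> \oo] --> 0 /\
    forall n : nat, (n0 < n)%N ->
      exists G : sgraph 'I_n,
        (1 - eps) * Num.sqrt (n%:R * ln n%:R / 2) <= (min_degree G)%:R /\
        1 - r n <= Gn2_pr R (fun F => ~ hamiltonian (gunion G F)).
Proof.
(* Capping eps at 1/2 keeps 1 - e bounded away from zero, and only makes the
   degree bound stronger. *)
pose e : R := Num.min eps 2^-1.
have e0 : 0 < e by rewrite lt_min heps /= invr_gt0 ltr0n.
have e2 : e <= 2^-1 by rewrite ge_min lexx orbT.
have eeps : e <= eps by rewrite ge_min lexx.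
pose C : R := 10 * (4 / e + 16 / e ^+ 2).
have C0 : 0 <= C by rewrite mulr_ge0 // addr_ge0 // divr_ge0 // ?exprn_ge0 // ltW.
exists (Num.truncn (expR (32 / e ^+ 2))).+1, (fun n => C / ln n%:R).
split; first exact: cvg_const_div_ln.
move=> n nlarge; have nE : expR (32 / e ^+ 2) <= n%:R.
  apply: ltW; apply: lt_le_trans (truncnS_gt _) _.
  by rewrite ler_nat ltnW.
have LE : 32 / e ^+ 2 <= ln n%:R.
  rewrite -[leLHS]expRK ler_ln ?posrE ?expR_gt0 //.
  exact: lt_le_trans (expR_gt0 _) nE.
set q := Num.sqrt _.
have q0 : 0 <= q by exact: sqrtr_ge0.
have [m [m0 qm mq]] : exists m, [/\ (0 < m)%N, (1 - e) * q <= m%:R &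
    m%:R <= (1 - e) * q + 1].
  exists (Num.truncn ((1 - e) * q)).+1; split=> //.
    by rewrite ltW // truncnS_gt.
  by rewrite -natr1 lerD2r truncn_le mulr_ge0 //; lra.
have e02 : 0 < e <= 2^-1 by rewrite e0.
have [n2 mn mule lnm] := small_side_bounds e02 LE mq.
pose A := [set i : 'I_n | (i < m)%N]%SET.
have cA : #|A| = m.
  have mn' : (m <= n)%N := leq_trans (leq_addl m m) mn.
  rewrite -[RHS]card_ord.
  have wI : injective (widen_ord mn') by move=> i j [] /val_inj.
  rewrite -[RHS](card_imset _ wI).
  apply: eq_card => i; rewrite inE; apply/idP/imsetP => [im|[j _ ->]] //=.
  by exists (Ordinal im) => //; apply: val_inj.
have cCA : #|~: A| = (n - m)%N.
  by have := cardsC A; rewrite card_ord cA; lia.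
exists (crossing A); split.
  apply: (@le_trans _ _ m%:R).
    apply: le_trans qm.
    by rewrite ler_wpM2r //; lra.
  by rewrite ler_nat -cA crossing_min_degree // cCA cA; lia.
have A0 : A != finset.set0 by rewrite -card_gt0 cA.
set mu := m%:R ^+ 2 / n%:R in mule.
pose h : R := \sum_(m <= i < n) i.+1%:R^-1.
have L0 : 0 < ln n%:R :> R.
  by apply: lt_le_trans LE; rewrite divr_gt0 // exprn_gt0.
have hge : (2^-1 - e / 4) * ln n%:R <= h.
  apply: le_trans (harmonic_ge_ln R (_ : m <= n)%N); last exact: leq_trans (leq_addl m m) mn.
  have : ln n%:R <= ln n.+1%:R :> R.
    by rewrite ler_ln ?posrE ?ltr0n ?ler_nat // ltnW // ltnW.
  move: lnm; lra.
have hmu : e / 4 * ln n%:R <= h - mu by lra.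
have eL0 : 0 < e / 4 * ln n%:R by rewrite mulr_gt0 // divr_gt0.
have d0 : 0 < h - mu by lra.
have := @crossing_Gn2_pr R 'I_n A h; rewrite card_ord cA -/mu.
move=> /(_ n2 A0 erefl); rewrite -subr_gt0 => /(_ d0); apply: le_trans.
rewrite lerD2l lerN2 /C -mulrA -mulrA ler_wpM2l //.
have mu0 : 0 <= mu by rewrite divr_ge0 ?exprn_ge0.
(* Each summand is decreasing in h, so the lower bound on h suffices. *)
have -> : (h + mu) / (h - mu) ^+ 2 = (h - mu)^-1 + 2 * mu / (h - mu) ^+ 2.
  by field; rewrite gt_eqF.
have inv : (h - mu)^-1 <= 4 / e / ln n%:R.
  have -> : 4 / e / ln n%:R = (e / 4 * ln n%:R)^-1 by field; rewrite !gt_eqF.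
  by rewrite lef_pV2 ?posrE.
rewrite [leRHS]mulrDl lerD //.
have -> : 16 / e ^+ 2 / ln n%:R = ln n%:R * (4 / e / ln n%:R) ^+ 2.
  by field; rewrite !gt_eqF.
rewrite -exprVn; apply: ler_pM; rewrite ?mulr_ge0 ?exprn_ge0 ?invr_ge0 ?(ltW d0) //.
  have : 0 <= e * ln n%:R by rewrite mulr_ge0 // ltW.
  lra.
by rewrite lerXn2r ?nnegrE ?invr_ge0 ?(ltW d0) // !divr_ge0 // ltW.
Qed.
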